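(* For any fixed integer $d\geq 1$, the integrality gap of the spreading LP for the bounded version of $d$-dimAP+ is $\Omega(k^{1/d})$; that is, there is a constant $c>0$ (depending on $d$) such that for infinitely many $k$ there are instances of bounded $d$-dimAP+ with $k$ terminals whose optimal integral cost is at least $c\,k^{1/d}$ times the optimal LP value.
   Context: Bounded $d$-dimAP+: the input is a graph $G=(V,E)$ with $|V|=n=r^d$ ($r$ an integer), nonnegative edge weights $w$, terminals $T\subseteq V$ with $|T|=k$, and an injective $f_0:T\to\{1,\ldots,r\}^d$; a feasible solution is an injective $f:V\to\{1,\ldots,r\}^d$ with $f|_T=f_0$, of cost $\sum_{\{u,v\}\in E}w_{uv}\|f(u)-f(v)\|_2$, to be minimized. The spreading LP has as variables a metric $d$ on $V$ and is: minimize $\sum_{\{u,v\}\in E}w_{uv}\,d(u,v)$ subject to $\sum_{v\in S}d(u,v)\geq (|S|-1)^{1+1/d}/4$ for all $S\subseteq V$ and $u\in S$, and $d(u,v)=\|f_0(u)-f_0(v)\|_2$ for all $u,v\in T$. The integrality gap is the supremum over instances of the ratio of the optimal integral cost to the optimal LP value. *)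

(* Defs.v *)
(* MathComp / MathComp-Analysis development. *)
From HB Require Import structures.
From mathcomp Require Import all_boot all_order all_algebra.
From mathcomp Require Import boolp classical_sets reals exp.

Set Implicit Arguments.
Unset Strict Implicit.
Unset Printing Implicit Defensive.

Import Order.TTheory GRing.Theory Num.Theory.

Local Open Scope ring_scope.
Local Open Scope classical_set_scope.

(* The grid {1,...,r}^d, with coordinates shifted to {0,...,r-1}; only
   differences of coordinates are ever used. *)
Definition grid (d r : nat) : finType := {ffun 'I_d -> 'I_r}.

(* The norm of the library's matrices is the sup norm, hence this definition. *)
Definition l2dist (R : realType) (d r : nat) (p q : grid d r) : R :=
  Num.sqrt (\sum_(i < d) ((p i)%:R - (q i)%:R) ^+ 2).

Record is_metric (R : realType) (V : Type) (dist : V -> V -> R) : Prop := {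
  metric_ge0 : forall u v, 0 <= dist u v;
  metric_eq0 : forall u v, dist u v = 0 <-> u = v;
  metric_sym : forall u v, dist u v = dist v u;
  metric_triangle : forall u v x, dist u x <= dist u v + dist v x
}.

(* Instances of bounded d-dimAP+.  Weights are only constrained on edges, and
   the values of [preplaced] (the map f_0) are only relevant on [terminals]. *)
Record instance (R : realType) (d : nat) := Instance {
  side : nat;
  vertex : finType;
  card_vertex : #|vertex| = (side ^ d)%N;
  edge : rel vertex;
  edge_sym : symmetric edge;
  edge_irr : irreflexive edge;
  weight : vertex -> vertex -> R;
  weight_sym : forall u v, edge u v -> weight u v = weight v u;
  weight_ge0 : forall u v, edge u v -> 0 <= weight u v;
  terminals : {set vertex};
  preplaced : vertex -> grid d side;
  preplaced_inj : {in terminals &, injective preplaced}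
}.

Section Problem.
Variables (R : realType) (d : nat) (I : instance R d).

(* Each undirected edge occurs twice among the ordered pairs, whence the
   factor 1/2. *)
Definition cost (dist : vertex I -> vertex I -> R) : R :=
  (\sum_(u : vertex I) \sum_(v : vertex I | edge u v)
     weight u v * dist u v) / 2.

Definition placement (f : vertex I -> grid d (side I)) : Prop :=
  injective f /\ {in terminals I, f =1 @preplaced R d I}.

Definition placement_cost (f : vertex I -> grid d (side I)) : R :=
  cost (fun u v => l2dist R (f u) (f v)).

Definition spreading (dist : vertex I -> vertex I -> R) : Prop :=
  forall (S : {set vertex I}) (u : vertex I), u \in S ->
    ((#|S| - 1)%N%:R `^ (1 + d%:R^-1)) / 4 <= \sum_(v in S) dist u v.

Definition LP_feasible (dist : vertex I -> vertex I -> R) : Prop :=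
  [/\ is_metric dist,
      spreading dist
    & {in terminals I &, forall u v,
        dist u v = l2dist R (preplaced u) (preplaced v)}].

(* Costs of feasible solutions are nonnegative, so these infima are genuine
   whenever a feasible solution exists; [inf set0] is 0 by convention. *)
Definition opt : R := inf [set placement_cost f | f in placement].

Definition LP_opt : R := inf [set cost dist | dist in LP_feasible].

End Problem.

(* Main.v *)
(* All the vertices but one are preplaced, on all the points of the grid but the
   corner [far]; the remaining vertex is therefore forced onto [far], and the
   only edge joins it to the vertex placed at the opposite corner [near], so
   that the integral cost is at least r - 1.  The LP may instead put the free
   vertex at distance 1 from [near].  This is feasible because among n points of
   Z^d the sum of the distances to a given point exceeds the spreading bound
   by enough to absorb one additional point at a distance at least 1. *)
Require Import Defs.
From mathcomp Require Import all_boot all_order all_algebra.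
From mathcomp Require Import boolp classical_sets reals exp.
From mathcomp Require Import zify ring lra.
Set Implicit Arguments.
Unset Strict Implicit.
Unset Printing Implicit Defensive.
Import Order.TTheory GRing.Theory Num.Theory.
Local Open Scope ring_scope.

(** * Euclidean and sup distances on the grid *)

(** Cauchy-Schwarz, by expanding the nonnegative sum of [(B * a i - A * b i) ^+ 2] with [A] and [B]
    the two norms; a zero norm is set apart because [A * B] is cancelled at the end. *)
Lemma sumr_mul_le_sqrt (R : realType) (n : nat) (a b : 'I_n -> R) :
  \sum_i a i * b i <= Num.sqrt (\sum_i a i ^+ 2) * Num.sqrt (\sum_i b i ^+ 2).
Proof.
have sq_ge0 (c : 'I_n -> R) : 0 <= \sum_i c i ^+ 2.
  by apply: sumr_ge0 => i _; exact: sqr_ge0.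
set A := Num.sqrt _; set B := Num.sqrt _.
have [A0 B0] : 0 <= A /\ 0 <= B by split; exact: sqrtr_ge0.
have EA : \sum_i a i ^+ 2 = A ^+ 2 by rewrite sqr_sqrtr.
have EB : \sum_i b i ^+ 2 = B ^+ 2 by rewrite sqr_sqrtr.
have eq0 (c : 'I_n -> R) : \sum_i c i ^+ 2 = 0 -> forall i, c i = 0.
  move=> c0 i; apply/eqP; rewrite -sqrf_eq0; apply/eqP.
  by move/psumr_eq0P : c0; apply=> // j _; exact: sqr_ge0.
have [Az|Anz] := eqVneq A 0.
  rewrite Az mul0r big1 // => i _; rewrite eq0 ?mul0r //.
  by rewrite EA Az expr0n.
have [Bz|Bnz] := eqVneq B 0.
  rewrite Bz mulr0 big1 // => i _; rewrite (eq0 b) ?mulr0 //.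
  by rewrite EB Bz expr0n.
have AB : 0 < A * B by rewrite mulr_gt0 // lt0r ?Anz ?Bnz.
have := sq_ge0 (fun i => B * a i - A * b i).
have expand i : (B * a i - A * b i) ^+ 2 = B ^+ 2 * a i ^+ 2
    + A ^+ 2 * b i ^+ 2 - (2 * (A * B)) * (a i * b i) by ring.
under eq_bigr => i _ do rewrite expand.
rewrite sumrB big_split /= -!mulr_sumr EA EB => h.
rewrite -(ler_pM2l AB); nra.
Qed.

(** Minkowski's inequality: after squaring, Cauchy-Schwarz bounds the cross terms. *)
Lemma sqrt_sum_sqrD (R : realType) (n : nat) (a b : 'I_n -> R) :
  Num.sqrt (\sum_i (a i + b i) ^+ 2) <=
  Num.sqrt (\sum_i a i ^+ 2) + Num.sqrt (\sum_i b i ^+ 2).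
Proof.
have sq_ge0 (c : 'I_n -> R) : 0 <= \sum_i c i ^+ 2.
  by apply: sumr_ge0 => i _; exact: sqr_ge0.
rewrite -(@ler_pXn2r _ 2) ?nnegrE ?addr_ge0 ?sqrtr_ge0 //.
rewrite sqr_sqrtr // sqrrD !sqr_sqrtr //.
have expand i : (a i + b i) ^+ 2 = a i ^+ 2 + 2 * (a i * b i) + b i ^+ 2.
  by ring.
under eq_bigr => i _ do rewrite expand.
rewrite !big_split /= lerD2r lerD2l -mulr_sumr -[leRHS]mulr_natl.
by rewrite ler_pM2l ?ltr0n // sumr_mul_le_sqrt.
Qed.

Lemma l2dist_ge0 (R : realType) (d r : nat) (p q : grid d r) :
  0 <= l2dist R p q.
Proof. exact: sqrtr_ge0. Qed.

Lemma l2distC (R : realType) (d r : nat) (p q : grid d r) :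
  l2dist R p q = l2dist R q p.
Proof. by congr Num.sqrt; apply: eq_bigr => i _; rewrite -sqrrN opprB. Qed.

Lemma l2dist_triangle (R : realType) (d r : nat) (p q s : grid d r) :
  l2dist R p s <= l2dist R p q + l2dist R q s.
Proof.
apply: le_trans (sqrt_sum_sqrD _ _).
rewrite le_eqVlt; apply/orP; left; apply/eqP; congr Num.sqrt.
by apply: eq_bigr => i _; rewrite addrA subrK.
Qed.

(* Both subtractions are truncated, so their sum is |p i - q i|. *)
Definition supdist (d r : nat) (p q : grid d r) : nat :=
  \max_(i < d) ((p i - q i) + (q i - p i))%N.

Lemma leq_supdist (d r : nat) (p q : grid d r) (i : 'I_d) :
  ((p i - q i) + (q i - p i) <= supdist p q)%N.
Proof.
exact: (@leq_bigmax _ (fun i => (p i - q i) + (q i - p i))%N i).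
Qed.

Lemma supdist_le_l2dist (R : realType) (d r : nat) (p q : grid d r) :
  (supdist p q)%:R <= l2dist R p q.
Proof.
apply: (big_ind (fun m : nat => m%:R <= l2dist R p q)) => [|m n hm hn|i _].
- exact: l2dist_ge0.
- by rewrite /maxn; case: ifP.
rewrite -[_%:R]ger0_norm // -sqrtr_sqr; apply: ler_wsqrtr.
rewrite (bigD1 i) //= -[leLHS]addr0; apply: lerD; last first.
  by apply: sumr_ge0 => j _; exact: sqr_ge0.
case: (leqP (p i) (q i)) => [pq|/ltnW qp].
  by rewrite (eqP pq) add0n natrB // -sqrrN opprB.
by rewrite (eqP qp) addn0 natrB.
Qed.

Lemma l2dist_eq0 (R : realType) (d r : nat) (p q : grid d r) :
  l2dist R p q = 0 <-> p = q.
Proof.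
split=> [pq|->]; last first.
  by rewrite /l2dist big1 ?sqrtr0 // => i _; rewrite subrr expr0n.
have := supdist_le_l2dist R p q; rewrite pq lern0 => /eqP D0.
apply/ffunP => i; apply/val_inj => /=.
have := leq_supdist p q i.
by rewrite D0 leqn0 addn_eq0 !subn_eq0 -eqn_leq => /eqP.
Qed.

(** * Layer-cake bound for sums of grid distances *)

(** Translation by [t - p] maps the ball injectively into the cube {0,...,2t}^d; [t] is added first
    because subtraction truncates. *)
Lemma card_supball (d r : nat) (S : {set grid d r}) (p : grid d r) (t : nat) :
  (#|[set v in S | supdist p v <= t]| <= (2 * t + 1) ^ d)%N.
Proof.
have := @leq_card_in _ {ffun 'I_d -> 'I_(2 * t).+1}
  (fun v : grid d r => [ffun i => inord (v i + t - p i)])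
  (mem [set v in S | supdist p v <= t])%N.
rewrite card_ffun !card_ord addn1; apply=> v w.
have shift_lt (a b : nat) :
  (a - b + (b - a) <= t -> b + t - a < (2 * t).+1)%N by lia.
have shift_inj (a b c : nat) : (a - b + (b - a) <= t ->
  a - c + (c - a) <= t -> b + t - a = c + t - a -> b = c)%N by lia.
rewrite !inE => /andP[_ pv] /andP[_ pw] /ffunP vw.
apply/ffunP => i; apply/val_inj => /=.
have {}pv := leq_trans (leq_supdist p v i) pv.
have {}pw := leq_trans (leq_supdist p w i) pw.
have /(congr1 val) := vw i; rewrite !ffunE /= !inordK ?shift_lt //.
exact: shift_inj.
Qed.

Lemma sum_ltn_le (J D : nat) : (\sum_(t < J) (t < D) <= D)%N.
Proof.
suff -> : (\sum_(t < J) (t < D) = minn J D)%N by exact: geq_minr.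
elim: J => [|J IH]; first by rewrite big_ord0 min0n.
by rewrite big_ord_recr /= IH; case: ltnP; lia.
Qed.

(** A point at sup-distance D from [p] lies outside at most D of the balls of radius t < J, and each
    ball holds at most (2t+1)^d points of [S]. *)
Lemma layers_le_sum_supdist (d r J : nat) (S : {set grid d r}) (p : grid d r) :
  (\sum_(t < J) #|S| <=
   \sum_(v in S) supdist p v + \sum_(t < J) (2 * t + 1) ^ d)%N.
Proof.
apply: (@leq_trans (\sum_(v in S) \sum_(t < J) (t < supdist p v)%N
  + \sum_(t < J) (2 * t + 1) ^ d)); last first.
  by rewrite leq_add2r leq_sum // => v _; exact: sum_ltn_le.
rewrite exchange_big -big_split /=; apply: leq_sum => t _.
have card_split :
    (\sum_(v in S) (t < supdist p v)%N + #|[set v in S | supdist p v <= t]|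
     = #|S|)%N.
  rewrite -sum1_card -[RHS]sum1_card.
  under [X in (_ + X)%N]eq_bigl => v do rewrite inE.
  rewrite big_mkcondr -big_split /=.
  by apply: eq_bigr => v _; case: leqP.
by rewrite -card_split leq_add2l card_supball.
Qed.

(* With s = n^(1/d), this is the layer-cake lower bound for the sum of the
   sup-distances from a point to n points of Z^d.  It follows from
   s^d - a^d >= (s - a) (1 + s + ... + s^(d-1)) for 1 <= a <= s, the case
   d = 1 being (s - 2J)^2 <= 1. *)
Lemma layers_ge (R : realType) (d J : nat) (s : R) :
  (0 < d)%N -> 1 <= s -> J%:R * 2 - 1 <= s -> s <= J%:R * 2 + 1 ->
  (s ^+ d.+1 - 1) / 4 <= \sum_(t < J) (s ^+ d - (2 * t + 1)%:R ^+ d).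
Proof.
move=> d0 s1 Js sJ.
pose G : R := \sum_(i < d) s ^+ i.
have G0 : 0 <= G by apply: sumr_ge0 => i _; apply: exprn_ge0; lra.
have sG : s ^+ d - 1 = (s - 1) * G by rewrite subrX1.
have sumJ : \sum_(t < J) (s - (2 * t + 1)%:R) = J%:R * s - J%:R ^+ 2.
  elim: J {Js sJ} => [|J IH]; first by rewrite big_ord0; ring.
  by rewrite big_ord_recr /= IH -natr1 natrD natrM; ring.
have ssd : s <= s ^+ d by rewrite ler_eXnr.
apply: (@le_trans _ _ (\sum_(t < J) (s - (2 * t + 1)%:R) * G)).
  rewrite -mulr_suml sumJ.
  have : (s ^+ 2 - 1) / 4 * G <= (J%:R * s - J%:R ^+ 2) * G.
    apply: ler_wpM2r => //; nra.
  apply: le_trans.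
  (* What remains is [s ^+ d.+1 - 1 <= (s + 1) * (s ^+ d - 1)], that is [s <= s ^+ d]. *)
  have -> : (s ^+ 2 - 1) / 4 * G = (s + 1) * ((s - 1) * G) / 4 by field.
  rewrite -sG exprS; nra.
apply: ler_sum => t _; set a : R := _%:R.
have a1 : 1 <= a by rewrite ler1n addn1.
have aJ : a <= s.
  apply: le_trans Js; rewrite /a natrD natrM.
  have : t.+1%:R <= J%:R :> R by rewrite ler_nat.
  by rewrite -natr1; lra.
(* In the factorization of s^d - a^d by s - a, the powers of [a] in the cofactor are at least 1;
   without them it is [G] in reverse order. *)
rewrite subrXX ler_wpM2l ?subr_ge0 //.
rewrite [leLHS](reindex_inj rev_ord_inj) /=; apply: ler_sum => i _.
have -> : (d - i.+1 = d.-1 - i)%N by lia.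
by rewrite ler_peMr ?exprn_ege1 // exprn_ge0 //; lra.
Qed.

Lemma powR_invnK (R : realType) (d n : nat) :
  (0 < d)%N -> ((n%:R : R) `^ d%:R^-1) ^+ d = n%:R.
Proof.
move=> d0; rewrite -powR_mulrn ?powR_ge0 // -powRrM mulVf ?powRr1 //.
by rewrite pnatr_eq0 -lt0n.
Qed.

Lemma powR_1Dinvn (R : realType) (d n : nat) :
  (0 < d)%N -> (n%:R : R) `^ (1 + d%:R^-1) = ((n%:R : R) `^ d%:R^-1) ^+ d.+1.
Proof.
move=> d0; rewrite exprS powR_invnK // powRD ?powRr1 1?mulrC //.
by rewrite paddr_eq0 ?oner_eq0 // invr_ge0.
Qed.

(** Split (x+1)^(1+q) as x(x+1)^q + (x+1)^q. With x = n - 1 and q = 1/d, this compares the spreading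
    bound for n points with n^(1+1/d) - 1. *)
Lemma powR_D1_ge (R : realType) (x q : R) :
  0 <= x -> 0 <= q -> x `^ (1 + q) + 1 <= (x + 1) `^ (1 + q).
Proof.
move=> x0 q0; have q1 : (1 + q == 0) = false by apply/negbTE; lra.
rewrite !powRD ?q1 // !powRr1 ?addr_ge0 // mulrDl mul1r lerD //.
  by rewrite ler_wpM2l // ge0_ler_powR ?nnegrE ?addr_ge0 // lerDl.
by rewrite -[leLHS](@powRr0 _ (x + 1)) ler_powR // lerDr.
Qed.

(* The numerator loses only 1 with respect to |S|^(1+1/d): this is what leaves
   room for one extra point at distance 1 from p in the spreading constraint. *)
Lemma sum_l2dist_ge (R : realType) (d r : nat) (S : {set grid d r})
    (p : grid d r) : (0 < d)%N ->
  ((#|S|%:R : R) `^ (1 + d%:R^-1) - 1) / 4 <= \sum_(v in S) l2dist R p v.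
Proof.
move=> d0; have [->|S0] := eqVneq S finset.set0.
  rewrite big_set0 cards0 powR0 ?sub0r; first by lra.
  by rewrite paddr_eq0 ?oner_eq0 // invr_ge0.
rewrite powR_1Dinvn //; set s := powR _ _.
have sd : s ^+ d = #|S|%:R by exact: powR_invnK.
have s0 : 0 <= s by exact: powR_ge0.
have s1 : 1 <= s by rewrite -(@expr_ge1 _ d s) // sd ler1n card_gt0.
(* With this [J], exactly the layers with 2t + 1 <= s are counted, and 2J is within 1 of s. *)
pose J := Num.truncn ((s + 1) / 2).
have /andP[J1 J2] : J%:R <= (s + 1) / 2 < J.+1%:R by apply: truncn_itv; lra.
apply: (le_trans (@layers_ge R d J s d0 s1 _ _)).
- by lra.
- by move: J2; rewrite -[J.+1]addn1 natrD; lra.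
apply: (@le_trans _ _ (\sum_(v in S) (supdist p v)%:R)); last first.
  by apply: ler_sum => v _; exact: supdist_le_l2dist.
rewrite sumrB lerBlDr sd.
under [X in _ <= _ + X]eq_bigr => t _ do rewrite -natrX.
by rewrite -!natr_sum -natrD ler_nat layers_le_sum_supdist.
Qed.

(** * The gap instance and its two optima *)

Section GapInstance.
Variables (R : realType) (d m : nat).
Hypothesis d_gt0 : (0 < d)%N.
(** Side at least 2, so that the corners [near] and [far] differ. *)
Let r := m.+2.
Let far : grid d r := [ffun=> ord_max].
Let near : grid d r := [ffun=> ord0].
Let adj : rel (grid d r) :=
  [rel u v | (u == far) && (v == near) || (u == near) && (v == far)].

Let near_neq_far : near != far.
Proof.
by apply/eqP => /ffunP /(_ (Ordinal d_gt0)); rewrite !ffunE => /(congr1 val).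
Qed.

Let adj_sym : symmetric adj.
Proof. by move=> u v; rewrite /adj /=; do 4![case: (_ == _)]. Qed.

Let adj_irr : irreflexive adj.
Proof.
move=> u; rewrite /adj /=; case: eqP => [->|_] /=; last by rewrite andbF.
by rewrite eq_sym (negPf near_neq_far).
Qed.

Let card_grid : #|grid d r| = (r ^ d)%N.
Proof. by rewrite card_ffun !card_ord. Qed.

Definition gap_instance : instance R d := @Instance R d r (grid d r) card_grid
  adj adj_sym adj_irr (fun _ _ => 1) (fun _ _ _ => erefl)
  (fun _ _ _ => ler01) (~: [set far])%SET id (fun _ _ _ _ e => e).

Let I := gap_instance.

Lemma cost_gap (dist : grid d r -> grid d r -> R) :
  @cost R d I dist = (dist far near + dist near far) / 2.
Proof.
congr (_ / 2).
transitivity (\sum_(uv : grid d r * grid d r | adj uv.1 uv.2) dist uv.1 uv.2).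
  rewrite -(pair_big_dep xpredT adj) /=.
  by apply: eq_bigr => u _; apply: eq_bigr => v _; rewrite mul1r.
rewrite (bigD1 (far, near)) /=; last by rewrite /adj /= !eqxx.
rewrite (bigD1 (near, far)) /=; last first.
  by rewrite /adj /= !eqxx orbT xpair_eqE (negPf near_neq_far).
rewrite big1 ?addr0 // => -[u v] /=.
by rewrite /adj /= !xpair_eqE => /andP[/andP[/orP[] /andP[-> ->]]].
Qed.

Definition collapse (u : grid d r) : grid d r := if u == far then near else u.

(** The Euclidean distance pulled back along [collapse], which merges [far] with [near], plus the
    cut pseudometric of [far], which separates them again, at distance 1. *)
Definition lp_dist (u v : grid d r) : R :=
  l2dist R (collapse u) (collapse v) + ((u == far) (+) (v == far))%:R.

Lemma lp_dist_metric : is_metric lp_dist.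
Proof.
split=> [u v|u v|u v|u v w].
- by rewrite addr_ge0 ?l2dist_ge0.
- split=> [/eqP|->]; last by rewrite /lp_dist addbb addr0; apply/l2dist_eq0.
  rewrite paddr_eq0 ?l2dist_ge0 // => /andP[/eqP/l2dist_eq0].
  rewrite /collapse pnatr_eq0.
  by case: eqP => [->|_]; case: eqP => [->|].
- by rewrite /lp_dist l2distC addbC.
- rewrite /lp_dist addrACA lerD ?l2dist_triangle // -natrD ler_nat.
  by do 3!case: (_ == far).
Qed.

(** If [far] is not in [S], then [collapse] fixes [S] and the bound for |S| points suffices.
    Otherwise that bound is applied to [S] minus [far], and the cut terms cover its deficit of
    1/4. *)
Lemma lp_dist_spreading : @spreading R d I lp_dist.
Proof.
have p_neq0 : 1 + d%:R^-1 != 0 :> R.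
  by rewrite paddr_eq0 ?oner_eq0 // invr_ge0.
move=> S u uS.
have [farS|farS] := boolP (far \in S); last first.
  have S0 : (0 < #|S|)%N by apply/card_gt0P; exists u.
  apply: (@le_trans _ _ ((#|S|%:R `^ (1 + d%:R^-1) - 1) / 4)).
    rewrite ler_pM2r ?invr_gt0 // lerBrDr.
    rewrite -[X in _ <= X%:R `^ _](subnK S0) natrD.
    by rewrite powR_D1_ge ?invr_ge0.
  apply: le_trans (sum_l2dist_ge R S (collapse u) d_gt0) _.
  apply: ler_sum => v vS; rewrite /lp_dist /collapse.
  have -> : (v == far) = false by apply: contraNF farS => /eqP <-.
  by rewrite lerDl.
rewrite (cardsD1 far) farS add1n subn1 /=.
set S' := (S :\ far)%SET.
have h := sum_l2dist_ge R S' (collapse u) d_gt0.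
(* For S = {far} the only cut term is 0, but so is the required bound. *)
have [S'0|S'0] := eqVneq S' finset.set0.
  rewrite S'0 cards0 powR0 // mul0r.
  by apply: sumr_ge0 => v _; exact: metric_ge0 lp_dist_metric _ _.
have far1 : 1 <= \sum_(v in S) ((u == far) (+) (v == far))%:R :> R.
  (* A point across the cut from [u]: [far] itself, or any other point of [S] if [u] is [far]. *)
  have [v vS uv] : exists2 v, v \in S & (u == far) (+) (v == far).
    case: (boolP (u == far)) => [_|_]; last by exists far; rewrite ?eqxx.
    by case/set0Pn: S'0 => v; rewrite !inE => /andP[? ?]; exists v.
  rewrite (bigD1 v) //= uv lerDl; apply: sumr_ge0 => w _; exact: ler0n.
rewrite big_split /=.
have : \sum_(v in S') l2dist R (collapse u) v
    <= \sum_(v in S) l2dist R (collapse u) (collapse v).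
  rewrite [leRHS](bigD1 far) //= -[leLHS]add0r lerD ?l2dist_ge0 //.
  rewrite le_eqVlt; apply/orP; left; apply/eqP.
  apply: eq_big => [v|v]; rewrite !inE; first by rewrite andbC.
  by case/andP => /negPf vfar _; rewrite /collapse vfar.
by lra.
Qed.

Lemma lp_dist_feasible : @LP_feasible R d I lp_dist.
Proof.
split; [exact: lp_dist_metric|exact: lp_dist_spreading|move=> u v].
rewrite !inE /= /lp_dist /collapse => /negPf -> /negPf ->.
by rewrite addr0.
Qed.

(** The spreading constraint on the two endpoints of the edge gives it length at least 1/4. This
    keeps [LP_opt] positive. *)
Lemma LP_feasible_cost_ge (dist : grid d r -> grid d r -> R) :
  @LP_feasible R d I dist -> 4^-1 <= @cost R d I dist.
Proof.
case=> -[ge0 eq0 sym _] spr _; rewrite cost_gap.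
have := spr [set far; near]%SET far; rewrite !inE eqxx => /(_ isT).
rewrite cards2 eq_sym near_neq_far subn1 /= powR1 div1r.
rewrite big_setU1 ?inE 1?eq_sym //= big_set1 (sym near far).
have -> : dist far far = 0 by apply/eq0.
by lra.
Qed.

Lemma LP_opt_gap_gt0 : 0 < LP_opt I.
Proof.
apply: (@lt_le_trans _ _ 4^-1); first by rewrite invr_gt0.
apply: lb_le_inf.
  by exists (@cost R d I lp_dist), lp_dist => //; exact: lp_dist_feasible.
by move=> _ [dist /LP_feasible_cost_ge ? <-].
Qed.

Lemma LP_opt_gap_le1 : LP_opt I <= 1.
Proof.
have cost1 : @cost R d I lp_dist = 1.
  rewrite cost_gap /lp_dist /collapse eqxx (negPf near_neq_far) /=.
  have -> : l2dist R near near = 0 by apply/l2dist_eq0.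
  by field.
rewrite -cost1; apply: ge_inf.
  by exists 4^-1 => _ [dist /LP_feasible_cost_ge ? <-].
by exists lp_dist => //; exact: lp_dist_feasible.
Qed.

(** If [far] were sent to a terminal, that terminal, being fixed, would have the same image as
    [far], against injectivity. *)
Lemma placement_gap_id (f : grid d r -> grid d r) :
  @placement R d I f -> f =1 id.
Proof.
case=> /= f_inj f_id u; case: (eqVneq u far) => [->|u_far]; last first.
  by rewrite f_id // !inE.
apply/eqP/negPn/negP => ffar.
by case/eqP: (ffar); apply: f_inj; apply: f_id; rewrite !inE.
Qed.

Lemma opt_gap_ge : m.+1%:R <= opt I.
Proof.
apply: lb_le_inf.
  by exists (@placement_cost R d I id), id => //; split.
move=> _ [f /placement_gap_id f_id <-].
rewrite /placement_cost cost_gap !f_id (l2distC R near far).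
have : m.+1%:R <= l2dist R far near.
  apply: le_trans (supdist_le_l2dist R far near).
  rewrite ler_nat.
  have := leq_supdist far near (Ordinal d_gt0).
  by rewrite !ffunE /= subn0 sub0n addn0.
by lra.
Qed.

Lemma card_terminals_gap : #|terminals I| = (r ^ d - 1)%N.
Proof. by rewrite cardsC1 card_grid subn1. Qed.

End GapInstance.

Theorem theorem10 (R : realType) (d : nat) (hd : (1 <= d)%N) :
  exists c : R, 0 < c /\
    forall K : nat, exists k : nat, (K <= k)%N /\
      exists I : instance R d,
        [/\ #|terminals I| = k,
            0 < LP_opt I
          & c * (k%:R `^ d%:R^-1) * LP_opt I <= opt I].
Proof.
(* For r = K + 2 and k = r^d - 1, k^(1/d) is at most r, while the integral cost is at least r - 1 >=
   r/2 and the LP value at most 1. *)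
exists 2^-1; split; first by rewrite invr_gt0.
move=> K; exists (K.+2 ^ d - 1)%N; split.
  have : (K.+2 ^ 1 <= K.+2 ^ d)%N by rewrite leq_pexp2l.
  by rewrite expn1; lia.
exists (gap_instance R K hd); split.
- exact: card_terminals_gap.
- exact: LP_opt_gap_gt0.
have := LP_opt_gap_le1 R K hd; have := LP_opt_gap_gt0 R K hd.
have := opt_gap_ge R K hd.
set x := LP_opt _; set y := opt _ => yge x0 x1.
have kr : (K.+2 ^ d - 1)%N%:R `^ d%:R^-1 <= K.+2%:R :> R.
  rewrite -(@ler_pXn2r _ d) ?nnegrE ?powR_ge0 // powR_invnK // -natrX.
  by rewrite ler_nat leq_subr.
apply: le_trans yge.
apply: (@le_trans _ _ (2^-1 * K.+2%:R * 1)).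
  apply: ler_pM => //; rewrite ?mulr_ge0 ?powR_ge0 ?invr_ge0 ?(ltW x0) //.
  by rewrite ler_pM2l ?invr_gt0.
have : 0 <= K%:R :> R by [].
rewrite -[K.+2]addn2 -[K.+1]addn1 !natrD; lra.
Qed.
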